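(* Let $m\ge 0$ be an integer and let $f\in\mathcal{L}\text{-}\mathcal{P}(O)$ satisfy $M(f)\ge \sqrt{4-\frac{6}{m+2}}$. Then for every real $x$, $$V_m(f)(x)=\sum_{j=-m}^{m} (-1)^j\,\frac{f(x-j)\,f(x+j)}{(m-j)!\,(m+j)!}\ \ge 0 .$$
   Context: The class $\mathcal{L}\text{-}\mathcal{P}(O)$ consists of the real entire functions having a representation of the form $$f(x)=c\,x^{r}e^{\beta x}\prod_{k=1}^{\omega}\left(1+\frac{x}{x_k}\right)e^{-x/x_k},\qquad 0\le\omega\le\infty,$$ where $c,\beta$ are real, the $x_k$ are nonzero reals, $r$ is a nonnegative integer, and $\sum_k x_k^{-2}<\infty$. (It is the subclass of the Laguerre–Pólya class with no Gaussian factor; it contains all real polynomials having only real zeros.) The mesh $M(f)$ of $f$ is the infimum of the distances between consecutive zeros of $f$, where the (real) zeros are listed in nondecreasing order and repeated according to multiplicity (so a multiple zero forces $M(f)=0$); if $f$ has at most one zero the infimum is over the empty set and $M(f)=+\infty$. *)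

(* Defs.v *)
(* Written with MathComp-Analysis, over an arbitrary [R : realType]. *)
From HB Require Import structures.
From mathcomp Require Import all_boot all_order all_algebra.
From mathcomp Require Import all_classical all_reals all_analysis.
Set Implicit Arguments.
Unset Strict Implicit.
Unset Printing Implicit Defensive.
Import Order.TTheory GRing.Theory Num.Theory.
Import numFieldNormedType.Exports.
Local Open Scope classical_set_scope.
Local Open Scope ring_scope.

(* A real entire function is identified with its restriction to the real line,
   i.e. with the sum of a real power series converging everywhere. *)
Definition real_entire (R : realType) (f : R -> R) : Prop :=
  exists a : R^nat, forall x : R, pseries a x @ \oo --> f x.

(* The number of factors of a product, [None] standing for infinity; the
   factors are indexed from 0. *)
Definition in_range (omega : option nat) (k : nat) : bool :=
  if omega is Some n then (k < n)%N else true.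

(* The values [xk k] with [k] out of range are irrelevant. For a finite [omega]
   the partial products are eventually constant. *)
Definition LPO (R : realType) (f : R -> R) : Prop :=
  real_entire f /\
  exists (c beta : R) (r : nat) (omega : option nat) (xk : R^nat),
    [/\ forall k : nat, in_range omega k -> xk k != 0,
        cvgn (fun n : nat => \sum_(k < n | in_range omega k) (xk k) ^- 2) &
        forall x : R,
          (fun n : nat => c * x ^+ r * expR (beta * x) *
             \prod_(k < n | in_range omega k)
               ((1 + x / xk k) * expR (- (x / xk k)))) @ \oo --> f x].

Definition zero_mult_ge (R : realType) (f : R -> R) (n : nat) (a : R) : Prop :=
  forall i : nat, (i < n)%N -> derive1n i f a = 0.

(* [a] and [b] are adjacent entries of the nondecreasing list of the zeros of
   [f] repeated according to multiplicity: two distinct zeros with no zero in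
   between, or two copies of the same multiple zero. *)
Definition consecutive_zeros (R : realType) (f : R -> R) (a b : R) : Prop :=
  [/\ a < b, f a = 0, f b = 0 & forall y : R, a < y -> y < b -> f y <> 0] \/
  a = b /\ zero_mult_ge f 2 a.

(* The infimum of the empty set is [+oo]. *)
Definition mesh (R : realType) (f : R -> R) : \bar R :=
  ereal_inf [set d : \bar R | exists a b : R,
    consecutive_zeros f a b /\ d = (b - a)%:E].

(* [absz] only converts the nonnegative integers [m - j] and [m + j] to
   [nat]. *)
Definition V (R : realType) (m : nat) (f : R -> R) (x : R) : R :=
  \sum_(i < (2 * m).+1)
    let j : int := i%:Z - m%:Z in
    (-1) ^ j * (f (x - j%:~R) * f (x + j%:~R)) /
      ((absz (m%:Z - j))`!%:R * (absz (m%:Z + j))`!%:R).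

(* Main.v *)
Require Import Defs.
From mathcomp Require Import all_boot all_order all_algebra.
From mathcomp Require Import all_classical all_reals all_analysis.
From mathcomp Require Import ring lra.
Import Order.TTheory GRing.Theory Num.Theory.
Import numFieldNormedType.Exports.
Set Implicit Arguments.
Unset Strict Implicit.
Local Open Scope ring_scope.

(** The proof rests on a divided difference. If [f y = C e^(B y) \prod_a (y - a)]
has finitely many real zeros and [u_a = (x - a)^2], then
[f (x - j) f (x + j) = C^2 e^(2 B x) \prod_a (u_a - j^2)], so that, up to the
positive factor [C^2 e^(2 B x)], [V m f x] is [(-1)^m] times the divided
difference at the nodes [0, 1, 4, .., m^2] of the polynomial
[t |-> \prod_a (u_a - t)] (lemma [V_exp_prod]). Call that signed divided
difference [D_m(us)], where [us] lists the [u_a]. The Leibniz rule for a linear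
factor reads
[D_m(u :: us) = (u - m^2) D_m(us) + D_(m-1)(us)] (lemma [divdiff_sq_cons]).

Induction on [m] and on the number of zeros then removes every zero with
[|x - a| >= m], because its coefficient [u - m^2] is nonnegative and a gap
sufficient for [m] is sufficient for [m - 1]. There remain zeros lying in an
open interval of length [2 m]; with gaps at least [d = sqrt (4 - 6 / (m + 2))]
there are at most [m + 1] of them. For fewer than [m], exactly [m], and exactly
[m + 1] zeros the divided difference has degree too low, picks the leading
coefficient, and equals [\sum_a u_a - \sum_(j <= m) j^2], respectively. In the
last case, [m + 1] points with gaps at least [d] satisfy
[\sum_a (x - a)^2 >= d^2 m (m + 1) (m + 2) / 12], with equality for equally
spaced points centred at [x]; this is at least [m (m + 1) (2 m + 1) / 6]
exactly when [d^2 >= 4 - 6 / (m + 2)]. This is lemma [divdiff_sq_ge0].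

A general [f] is the pointwise limit of its partial products, which have the
form above, and [V m f x] is a finite combination of values of [f], hence the
limit of the same expression for the partial products. It remains to see that
the zeros of the partial products inherit the gaps of [f]
([partial_zeros_separated]). This uses the two-sided Gaussian bounds on
[(1 + t) e^(- t)]: the upper one shows that a repeated zero of a partial product
is a double zero of [f] ([double_zero_limit]), and the lower one that all zeros
of [f] in a bounded set are zeros of a single partial product
([limit_zeros_bounded]), so that between two zeros of [f] at distance less than
[d] there would be two consecutive ones. *)

(** * The divided difference at the squares [0, 1, 4, .., m^2] *)

Section DividedDifference.
Variable R : realFieldType.
Implicit Types (us s : seq R) (u x d : R).

(** This is [(-1)^m] times the divided difference of [t |-> \prod_u (u - t)] at the
nodes [0, 1, 4, .., m^2]. The node [j^2] with [j > 0] appears twice, for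
[i = m - j] and [i = m + j], which accounts for the factor 2 in
[\prod_(k <> j) (j^2 - k^2) = (-1)^(m - j) (m - j)! (m + j)! / 2]. *)
Definition divdiff_sq (m : nat) (us : seq R) : R :=
  \sum_(i < m.*2.+1) (-1) ^+ (i + m) / ((m.*2 - i)`! * i`!)%:R *
     \prod_(u <- us) (u - (i%:R - m%:R) ^+ 2).

Lemma divdiff_sq_perm m us vs : perm_eq us vs -> divdiff_sq m us = divdiff_sq m vs.
Proof. by move=> p; apply: eq_bigr => i _; rewrite (perm_big _ p). Qed.

Lemma divdiff_sq0 us : divdiff_sq 0 us = \prod_(u <- us) u.
Proof.
rewrite /divdiff_sq big_ord_recl big_ord0 /= addr0 mul1r fact0 muln1 invr1 mul1r.
by apply: eq_bigr => u _; rewrite subrr expr0n subr0.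
Qed.

(** The constant 1 has no higher differences; the alternating sum of binomial
coefficients is [(1 - 1) ^ (2 m)]. *)
Lemma divdiff_sqS_nil m : divdiff_sq m.+1 [::] = 0.
Proof.
pose N := m.+1.*2; have : (1 - 1 : R) ^+ N = 0 by rewrite subrr expr0n.
rewrite exprBn => h.
apply: (@mulfI R (N`!%:R * (-1) ^+ m.+1)).
  by rewrite mulf_neq0 ?signr_eq0// pnatr_eq0 -lt0n fact_gt0.
rewrite mulr0 -[RHS]h mulr_sumr; apply: eq_bigr => i _.
have iN : (i <= N)%N by rewrite -ltnS.
rewrite big_nil mulr1 !expr1n !mulr1 exprD -/N -(bin_fact iN).
rewrite [(i`! * _)%N]mulnC natrM.
have : ((N - i)`! * i`!)%:R != 0 :> R by rewrite pnatr_eq0 -lt0n muln_gt0 !fact_gt0.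
set F := _%:R => F0; rewrite -[RHS]mulr_natr.
have := signrMK m.+1 (1 : R); rewrite mulr1; set s := (-1) ^+ m.+1 => e.
clearbody F; transitivity ((s * s) * ((-1) ^+ i * 'C(N, i)%:R)).
  by field; exact: F0.
by rewrite e mul1r.
Qed.

(** Split [u - j^2 = (u - (m + 1)^2) + (m + 1 - j) (m + 1 + j)] under the sum: the
second term cancels a factor of each of the two factorials and vanishes at
[j = m + 1] and [j = - (m + 1)], which leaves the sum for [m]. *)
Lemma divdiff_sq_cons m u us : divdiff_sq m.+1 (u :: us) =
  (u - m.+1%:R ^+ 2) * divdiff_sq m.+1 us + divdiff_sq m us.
Proof.
pose c i : R := (-1) ^+ (i + m.+1) / ((m.+1.*2 - i)`! * i`!)%:R *
   \prod_(u <- us) (u - (i%:R - m.+1%:R) ^+ 2).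
(* With [i = j + m + 1], the product [(m + 1 + j) (m + 1 - j)] is
   [i (2 (m + 1) - i)]. *)
have -> : divdiff_sq m us = \sum_(i < m.+1.*2.+1) (i%:R * (m.+1.*2 - i)%:R) * c i.
  rewrite big_ord_recl mul0r mul0r add0r doubleS big_ord_recr /= /bump leq0n.
  rewrite add1n subnn mulr0 mul0r addr0; apply: eq_bigr => i _.
  rewrite /bump leq0n add1n /c.
  have iN : (i <= m.*2)%N by rewrite -ltnS.
  have -> : (m.+1.*2 - i.+1 = (m.*2 - i).+1)%N by rewrite doubleS subSS subSn.
  rewrite !factS !natrM addnS addSn !exprS.
  have -> : i.+1%:R - m.+1%:R = i%:R - m%:R :> R by rewrite -!natr1; ring.
  set P := \prod_(_ <- _) _.
  have f1 : i`!%:R != 0 :> R by rewrite pnatr_eq0 -lt0n fact_gt0.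
  have f2 : (m.*2 - i)`!%:R != 0 :> R by rewrite pnatr_eq0 -lt0n fact_gt0.
  have f3 : i.+1%:R != 0 :> R by rewrite pnatr_eq0.
  have f4 : (m.*2 - i).+1%:R != 0 :> R by rewrite pnatr_eq0.
  move: f1 f2 f3 f4; move: (_`!%:R) (_`!%:R) (_.+1%:R) (_.+1%:R) => a b e d a0 b0 c0 d0.
  by field; rewrite a0 b0 c0 d0.
rewrite mulr_sumr -big_split /=; apply: eq_bigr => i _.
rewrite big_cons /c natrB; last by rewrite -ltnS.
rewrite (_ : m.+1.*2%:R = 2 * m.+1%:R); last by rewrite -natrM mul2n.
by ring.
Qed.

Lemma divdiff_sq_short m us : (size us < m)%N -> divdiff_sq m us = 0.
Proof.
elim: us m => [|u us IH] [|m] //= h; first exact: divdiff_sqS_nil.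
by rewrite divdiff_sq_cons !IH ?mulr0 ?addr0 // ltnW.
Qed.

Lemma divdiff_sq_size us : divdiff_sq (size us) us = 1.
Proof.
elim: us => [|u us IH] /=; first by rewrite divdiff_sq0 big_nil.
by rewrite divdiff_sq_cons IH divdiff_sq_short// mulr0 add0r.
Qed.

Lemma divdiff_sq_sizeS m us : size us = m.+1 ->
  divdiff_sq m us = \sum_(u <- us) u - \sum_(j < m.+1) j%:R ^+ 2.
Proof.
elim: m us => [|m IH] [|u us] //= [szu].
  move/size0nil: szu ->.
  by rewrite divdiff_sq0 !big_seq1 big_ord_recl big_ord0 expr0n addr0 subr0.
rewrite divdiff_sq_cons IH// -[in divdiff_sq _ us]szu divdiff_sq_size mulr1.
rewrite big_cons [in RHS]big_ord_recr /=.
by ring.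
Qed.

(** * Sums of squares of separated points *)

Lemma sum_sqr_pairs n (y : 'I_n -> R) :
  \sum_(i < n) \sum_(j < n) (y i - y j) ^+ 2 =
  2 * (n%:R * \sum_(i < n) y i ^+ 2 - (\sum_(i < n) y i) ^+ 2).
Proof.
have -> : \sum_(i < n) \sum_(j < n) (y i - y j) ^+ 2 =
    \sum_(i < n) (n%:R * y i ^+ 2 + \sum_(j < n) y j ^+ 2
                  - 2 * (\sum_(j < n) y j) * y i).
  apply: eq_bigr => i _.
  rewrite mulr_natl -[n in _ *+ n]card_ord -sumr_const mulr_sumr mulr_suml.
  by rewrite -sumrN -!big_split /=; apply: eq_bigr => j _; ring.
rewrite big_split /= sumrN -mulr_sumr big_split /= -mulr_sumr.
rewrite sumr_const card_ord -mulr_natl.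
by ring.
Qed.

Lemma sum_nat n : \sum_(j < n) j%:R = n%:R * (n%:R - 1) / 2 :> R.
Proof.
elim: n => [|n IH]; first by rewrite big_ord0 !mul0r.
by rewrite big_ord_recr /= IH -natr1; field.
Qed.

Lemma sum_sqr n : \sum_(j < n) j%:R ^+ 2 =
  n%:R * (n%:R - 1) * (2 * n%:R - 1) / 6 :> R.
Proof.
elim: n => [|n IH]; first by rewrite big_ord0 !mul0r.
by rewrite big_ord_recr /= IH -natr1; field.
Qed.

(** The second moment of [n] points is at least their variance, which depends only
on the pairwise distances ([sum_sqr_pairs]); these are at least those of the
points [d i], whose sums are known in closed form. *)
Lemma sum_sqr_separated_ge n (d : R) (y : 'I_n -> R) : 0 <= d ->
  (forall i j : 'I_n, (i <= j)%N -> d * (j%:R - i%:R) <= y j - y i) ->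
  d ^+ 2 * (n%:R * (n%:R ^+ 2 - 1) / 12) <= \sum_(i < n) y i ^+ 2.
Proof.
move=> d0 h; case: n y h => [|n] y h; first by rewrite big_ord0 !mul0r mulr0.
have n0 : 0 < n.+1%:R :> R by rewrite ltr0n.
have : \sum_(i < n.+1) \sum_(j < n.+1) (d * i%:R - d * j%:R) ^+ 2 <=
       \sum_(i < n.+1) \sum_(j < n.+1) (y i - y j) ^+ 2.
  apply: ler_sum => i _; apply: ler_sum => j _.
  wlog ij : i j / (i <= j)%N => [wl|].
    case: (leqP i j) => [/wl//|/ltnW/wl].
    by rewrite -[in X in _ -> X]sqrrN opprB -[in X in _ -> _ <= X]sqrrN opprB.
  rewrite -sqrrN opprB -[in leRHS]sqrrN opprB -mulrBr ler_sqr ?nnegrE//.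
  - exact: h.
  - by rewrite mulr_ge0// subr_ge0 ler_nat.
  - by apply: le_trans (h _ _ ij); rewrite mulr_ge0// subr_ge0 ler_nat.
rewrite !sum_sqr_pairs ler_pM2l// -mulr_sumr sum_nat.
under eq_bigr do rewrite exprMn; rewrite -mulr_sumr sum_sqr => H.
rewrite -(ler_pM2l n0); apply: le_trans (le_trans H _); last first.
  by rewrite lerBlDr lerDl sqr_ge0.
by rewrite le_eqVlt; apply/orP; left; apply/eqP; field.
Qed.

Definition separated d s : Prop :=
  uniq s /\ {in s &, forall a b, a < b -> d <= b - a}.

Lemma separated_perm d s t : perm_eq s t -> separated d s -> separated d t.
Proof.
move=> p [us h]; split; first by rewrite -(perm_uniq p).
by move=> a b; rewrite -!(perm_mem p); apply: h.
Qed.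

Lemma separated_behead d a s : separated d (a :: s) -> separated d s.
Proof.
move=> [/andP[_ us] h]; split=> // b c bs cs.
by apply: h; rewrite inE ?bs ?cs orbT.
Qed.

Lemma separated_nth d s i j : separated d s -> (i <= j < size s)%N ->
  d * (j%:R - i%:R) <= (sort <=%O s)`_j - (sort <=%O s)`_i.
Proof.
move=> /(@separated_perm _ _ (sort <=%O s)); rewrite perm_sym perm_sort.
move=> /(_ (perm_refl _)) [us h] /andP[ij js].
have ss : sorted <%O (sort <=%O s).
  by rewrite lt_sorted_uniq_le us sort_le_sorted.
elim: j ij js => [|j IH].
  by rewrite leqn0 => /eqP ->; rewrite !subrr mulr0.
rewrite leq_eqVlt ltnS => /orP[/eqP -> _|ij js]; first by rewrite !subrr mulr0.
have := IH ij (ltnW js).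
have : d <= (sort <=%O s)`_j.+1 - (sort <=%O s)`_j.
  apply: h; rewrite ?mem_nth ?size_sort ?(ltnW js)//.
  by rewrite (sorted_ltn_nth lt_trans 0 ss) ?inE ?size_sort ?(ltnW js).
by rewrite -natr1; lra.
Qed.

(** The core inequality. The hypothesis on [d] is [d^2 >= 4 - 6 / (m + 2)] cleared
of its denominator, the form in which it passes from [m + 1] to [m]. *)
Lemma divdiff_sq_ge0 m d x s : 0 <= d -> 4 * m%:R + 2 <= d ^+ 2 * (m%:R + 2) ->
  separated d s -> 0 <= divdiff_sq m [seq (x - a) ^+ 2 | a <- s].
Proof.
move=> d0; elim: m s => [|m IHm] s.
  move=> _ _; rewrite divdiff_sq0 big_map.
  by apply: prodr_ge0 => a _; apply: sqr_ge0.
move=> dm; have {}IHm := IHm _ _; have [n] := ubnP (size s).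
have m0 : 0 <= m%:R :> R by [].
have m1 : m.+1%:R = m%:R + 1 :> R by rewrite natr1.
have m2 : m.+2%:R = m%:R + 2 :> R by rewrite -natrD addn2.
have dm' : 4 * m%:R + 2 <= d ^+ 2 * (m%:R + 2).
  move: dm; rewrite m1; nra.
elim: n s => // n IHn s; rewrite ltnS => sn seps.
have [/hasP[a sa am]|/hasPn far] :=
    boolP (has (fun a => m.+1%:R ^+ 2 <= (x - a) ^+ 2) s).
  have p := perm_to_rem sa.
  have sep := separated_behead (separated_perm p seps).
  rewrite (divdiff_sq_perm _ (perm_map _ p)) /= divdiff_sq_cons.
  rewrite addr_ge0 ?IHm// mulr_ge0 ?subr_ge0// IHn//.
  by rewrite size_rem// (leq_trans _ sn)// prednK//; case: (s) sa.
have near a : a \in s -> `|x - a| < m.+1%:R.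
  by move/far; rewrite -ltNge -[X in X < _]real_normK ?num_real// ltr_sqr ?nnegrE.
set t := sort <=%O s.
have st : size t = size s by rewrite size_sort.
have tnear i : (i < size s)%N -> `|x - t`_i| < m.+1%:R.
  by move=> h; apply: near; rewrite -(mem_sort <=%O) mem_nth ?st.
(* Otherwise [m.+3] zeros would span at least [m.+2 * d], but all of them lie in
   an interval of length [2 * m.+1], which is shorter. *)
have szs : (size s <= m.+2)%N.
  rewrite leqNgt; apply/negP => szs.
  have := @separated_nth _ _ 0 m.+2 seps szs; rewrite -/t subr0.
  have := tnear _ szs; have := tnear _ (leq_ltn_trans (leq0n _) szs).
  rewrite !ltr_norml => /andP[a1 a2] /andP[b1 b2] h.
  have {h} : d * m.+2%:R < 2 * m.+1%:R by lra.
  rewrite -ltr_sqr ?nnegrE ?mulr_ge0// !exprMn.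
  move: dm; rewrite m1 m2; move: (d ^+ 2) (sqr_ge0 d) => e e0.
  nra.
have [szs'|szs'|szs'] := ltngtP (size s) m.+1.
- by rewrite divdiff_sq_short ?size_map.
- have {szs szs'} szs : size s = m.+2 by apply/eqP; rewrite eqn_leq szs.
  rewrite (@divdiff_sq_perm _ _ [seq (x - a) ^+ 2 | a <- t]); last first.
    by rewrite perm_map// perm_sym perm_sort.
  rewrite divdiff_sq_sizeS ?size_map ?st// subr_ge0 sum_sqr.
  rewrite big_map (big_nth 0) big_mkord st szs.
  under [leRHS]eq_bigr do rewrite -sqrrN opprB.
  apply: le_trans (@sum_sqr_separated_ge m.+2 d (fun i => t`_i - x) d0 _); last first.
    move=> i j ij; rewrite (_ : _ - _ - _ = t`_j - t`_i); last by ring.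
    by apply: separated_nth => //; rewrite ij szs /= ltn_ord.
  rewrite ?m1 ?m2 in dm *; move: (d ^+ 2) dm => e e0.
  set M : R := m%:R in m0 e0 *.
  have h : 0 <= (M + 2) * (M + 1) * (e * (M + 1 + 2) - (4 * (M + 1) + 2)) by nra.
  nra.
- rewrite -szs' -[in divdiff_sq _ _](size_map (fun a => (x - a) ^+ 2)).
  by rewrite divdiff_sq_size.
Qed.

End DividedDifference.

(** The exponential factors at [x - j] and [x + j] multiply to a constant, and
[(x - j - a) (x + j - a) = (x - a)^2 - j^2]. *)
Lemma V_exp_prod (R : realType) m (C B : R) (s : seq R) x :
  V m (fun y => C * expR (B * y) * \prod_(a <- s) (y - a)) x =
  (C * expR (B * x)) ^+ 2 * divdiff_sq m [seq (x - a) ^+ 2 | a <- s].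
Proof.
rewrite /V /divdiff_sq mulr_sumr mul2n; apply: eq_bigr => i _ /=.
have im : (i <= m.*2)%N by rewrite -ltnS.
have -> : absz (m%:Z - (i%:Z - m%:Z))%R = (m.*2 - i)%N.
  by rewrite opprB addrA -PoszD addnn subzn.
have -> : absz (m%:Z + (i%:Z - m%:Z))%R = i by rewrite addrC subrK.
have -> : (-1) ^ (i%:Z - m%:Z) = (-1) ^+ (i + m) :> R.
  rewrite expfzDr ?oppr_eq0 ?oner_eq0// exprD.
  by rewrite -exprnN -exprVn invrN1.
rewrite intrB -!pmulrn; set j : R := i%:R - m%:R.
have -> : \prod_(u <- [seq (x - a) ^+ 2 | a <- s]) (u - j ^+ 2) =
    (\prod_(a <- s) (x - j - a)) * (\prod_(a <- s) (x + j - a)).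
  by rewrite big_map -big_split /=; apply: eq_bigr => a _; ring.
have -> : (C * expR (B * x)) ^+ 2 =
    (C * expR (B * (x - j))) * (C * expR (B * (x + j))).
  rewrite mulrACA -expRD exprMn !expr2 -expRD; congr (_ * expR _).
  by ring.
by rewrite natrM; ring.
Qed.

(** * Gaussian bounds for the factors *)

Section Product.
Variable R : realType.
Local Open Scope classical_set_scope.

Definition primary_factor (t : R) : R := (1 + t) * expR (- t).
Local Notation E := primary_factor.

Lemma primary_factor_le t : `|E t| <= expR (t ^+ 2).
Proof.
rewrite normrM (gtr0_norm (expR_gt0 _)).
have [t1|t1] := leP (-1) t.
  rewrite ger0_norm; last by rewrite -lerBlDl sub0r.
  apply: (@le_trans _ _ 1); last by rewrite -expR0 ler_expR sqr_ge0.
  by rewrite expRN ler_pdivrMr ?expR_gt0// mul1r expR_ge1Dx.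
rewrite ltr0_norm; last lra.
apply: (@le_trans _ _ (expR (- 2 - t) * expR (- t))).
  rewrite ler_wpM2r ?expR_ge0//; apply: le_trans (expR_ge1Dx _).
  by rewrite le_eqVlt; apply/orP; left; apply/eqP; ring.
by rewrite -expRD ler_expR; nra.
Qed.

(** By [e^(- v) >= 1 - v] with [v = t - 2 t^2], it suffices that
[(1 + t) (1 - v) = 1 + t^2 (1 + 2 t) >= 1]. *)
Lemma primary_factor_ge t : - 2^-1 <= t -> expR (- (2 * t ^+ 2)) <= E t.
Proof.
move=> t2; rewrite /E.
rewrite -(ler_pM2r (expR_gt0 t)) -expRD -mulrA -expRD addNr expR0 mulr1.
set v := _ + t; have h : 1 - v <= expR (- v) by apply: expR_ge1Dx.
have v0 : 0 < expR v by apply: expR_gt0.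
have e1 : expR v * expR (- v) = 1 by rewrite -expRD subrr expR0.
have : expR v * (1 - v) <= 1 by rewrite -[leRHS]e1 ler_pM2l.
have : 1 <= (1 + t) * (1 - v).
  have : 0 <= t ^+ 2 * (1 + 2 * t) by rewrite mulr_ge0 ?sqr_ge0//; lra.
  by rewrite /v; nra.
have : 0 < 1 - v by rewrite /v; nra.
by move: (expR v) (1 - v) v0 => p q p0 q0 h1 h2; rewrite -(ler_pM2r q0); nra.
Qed.

(** * Partial products and their zeros *)

(** The factors are parametrized by the inverses [w k = 1 / x_k], so that [w k = 0]
stands for an absent factor and covers finite products. *)
Variables (c beta : R) (r : nat) (w : R^nat).

Definition partial (n : nat) (y : R) : R :=
  c * y ^+ r * expR (beta * y) * \prod_(k < n) E (y * w k).

Definition partial_zeros (n : nat) : seq R :=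
  nseq r 0 ++ [seq - (w k)^-1 | k <- iota 0 n & w k != 0].

Lemma partial_factored n : c != 0 -> exists C B : R, C != 0 /\
  forall y, partial n y =
    C * expR (B * y) * \prod_(a <- partial_zeros n) (y - a).
Proof.
move=> c0; elim: n => [|n [C [B [C0 IH]]]].
  exists c, beta; split=> // y.
  rewrite /partial /partial_zeros /= cats0 big_ord0 big_nseq subr0 iter_mulr_1.
  by ring.
pose D := if w n == 0 then 1 else w n.
exists (C * D), (B - w n); split.
  by rewrite mulf_neq0// /D; case: ifP => [_|->]; rewrite ?oner_neq0.
move=> y; rewrite /partial big_ord_recr /= mulrA -/(partial n y) IH.
have -> : partial_zeros n.+1 =
    partial_zeros n ++ (if w n != 0 then [:: - (w n)^-1] else [::]).
  rewrite /partial_zeros -addn1 iotaD add0n filter_cat map_cat catA /=.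
  by case: ifP.
move: (partial_zeros n) => s.
rewrite big_cat /= mulrBl expRD (mulrC y) /E -mulNr.
rewrite /D; case: eqVneq => [->|wn] /=.
  by rewrite big_nil oppr0 mul0r addr0 expR0; ring.
by rewrite big_seq1; field.
Qed.

Hypothesis c_neq0 : c != 0.
Variable S : R.
Hypothesis wS : forall n, \sum_(k < n) w k ^+ 2 <= S.
Variable f : R -> R.
Hypothesis partial_cvg : forall y, partial ^~ y @ \oo --> f y.

Lemma partial_split n N y : (n <= N)%N ->
  partial N y = partial n y * \prod_(n <= k < N) E (y * w k).
Proof.
move=> nN; rewrite /partial -[RHS]mulrA.
by rewrite -!(big_mkord predT (fun k => E (y * w k))) -big_cat_nat.
Qed.

Lemma sum_tail_le n N : \sum_(n <= k < N) w k ^+ 2 <= S.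
Proof.
have [Nn|/ltnW nN] := leqP N n.
  by rewrite big_geq//; have := wS 0; rewrite big_ord0.
apply: le_trans (wS N); rewrite -(big_mkord predT (fun k => w k ^+ 2)).
rewrite (big_cat_nat (m := 0) (n := n)) //= lerDr.
by apply: sumr_ge0 => i _; apply: sqr_ge0.
Qed.

Lemma tail_le n N y : `|\prod_(n <= k < N) E (y * w k)| <= expR (y ^+ 2 * S).
Proof.
rewrite normr_prod.
apply: (@le_trans _ _ (\prod_(n <= k < N) expR ((y * w k) ^+ 2))).
  by apply: ler_prod => k _; rewrite normr_ge0 primary_factor_le.
rewrite -expR_sum ler_expR; under eq_bigr do rewrite exprMn.
by rewrite -mulr_sumr ler_wpM2l ?sqr_ge0 ?sum_tail_le.
Qed.

Lemma tail_ge n N y : (forall k, (n <= k)%N -> `|y * w k| <= 2^-1) ->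
  expR (- (2 * (y ^+ 2 * S))) <= \prod_(n <= k < N) E (y * w k).
Proof.
move=> h.
apply: (@le_trans _ _ (\prod_(n <= k < N) expR (- (2 * (y * w k) ^+ 2)))).
  rewrite -expR_sum ler_expR sumrN lerN2 -mulr_sumr ler_pM2l//.
  under eq_bigr do rewrite exprMn.
  by rewrite -mulr_sumr ler_wpM2l ?sqr_ge0 ?sum_tail_le.
rewrite !big_nat; apply: ler_prod => k /andP[nk _]; rewrite expR_ge0 /=.
by apply: primary_factor_ge; have := h _ nk; rewrite ler_norml => /andP[].
Qed.

Lemma partial_eq0 n N a : a \in partial_zeros n -> (n <= N)%N -> partial N a = 0.
Proof.
move=> an /partial_split ->; have [C [B [_ ->]]] := partial_factored n c_neq0.
by rewrite (perm_big _ (perm_to_rem an)) big_cons /= subrr mul0r mulr0 mul0r.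
Qed.

Lemma partial_zeros_limit n a : a \in partial_zeros n -> f a = 0.
Proof.
move=> an; have /cvg_unique := @partial_cvg a; apply; first exact: Rhausdorff.
apply: cvg_near_cst; exists n => // N /= nN; exact: partial_eq0 an nN.
Qed.

Lemma parameter_small (e : R) :
  0 < e -> exists n, forall k, (n <= k)%N -> `|w k| <= e.
Proof.
move=> e0.
have : cvgn (series (fun k => w k ^+ 2)).
  apply: nondecreasing_is_cvgn.
    apply/nondecreasing_seqP => n.
    by rewrite /series /= big_nat_recr//= lerDl sqr_ge0.
  by exists S => _ [n _ <-]; rewrite /series /= big_mkord.
move=> /cvg_series_cvg_0 /cvgrPdist_le /(_ (e ^+ 2)).
rewrite exprn_gt0// => /(_ isT) [n _ h]; exists n => k nk.
have := h k nk; rewrite /= sub0r normrN normrX ler_sqr// nnegrE.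
exact: ltW.
Qed.

(** Once [|y w k| <= 1/2] for all [k >= n] and [|y| <= rho], the lower bound on the
tail keeps the limit away from zero unless the [n]-th partial product itself
vanishes. The uniformity of [n] makes the zeros of the limit locally finite. *)
Lemma limit_zeros_bounded (rho : R) : exists n, forall y,
  `|y| <= rho -> f y = 0 -> y \in partial_zeros n.
Proof.
have e0 : 0 < 2^-1 / (`|rho| + 1) by rewrite divr_gt0// ltr_wpDl.
have [n hn] := parameter_small e0; exists n => y yrho fy; apply/negPn/negP => ny.
have [C [B [C0 pn]]] := partial_factored n c_neq0.
have p0 : partial n y != 0.
  rewrite pn !mulf_neq0//; first by rewrite gt_eqF// expR_gt0.
  rewrite prodf_seq_neq0; apply/allP => a an; rewrite implyTb subr_eq0.
  by apply: contraNneq ny => ->.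
have small k : (n <= k)%N -> `|y * w k| <= 2^-1.
  move=> /hn; rewrite ler_pdivlMr ?ltr_wpDl// normrM => h; apply: le_trans h.
  rewrite mulrC ler_wpM2l//; apply: le_trans yrho _.
  by apply: le_trans (ler_norm _) _; rewrite lerDl.
have : `|partial n y| * expR (- (2 * (y ^+ 2 * S))) <= `|f y|.
  apply: (cvgr_to_ge (cvg_norm (@partial_cvg y))).
  exists n => // N /= nN; rewrite (partial_split _ nN) [leRHS]normrM ler_wpM2l//.
  by apply: le_trans (ler_norm _); apply: tail_ge.
by rewrite fy normr0 leNgt mulr_gt0 ?normr_gt0 ?expR_gt0.
Qed.

(** The upper bound on the tail is uniform in its length, so it passes to the limit
and gives [|f y| <= (y - a)^2 G y] with [G] continuous; hence [f] has derivative
zero at [a]. *)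
Lemma double_zero_limit n a s :
  perm_eq (partial_zeros n) [:: a, a & s] -> zero_mult_ge f 2 a.
Proof.
move=> p; have an : a \in partial_zeros n by rewrite (perm_mem p) mem_head.
case=> [|[|//]] _; first by rewrite derive1n0 (partial_zeros_limit an).
have [C [B [_ pn]]] := partial_factored n c_neq0.
pose G y := `|C * expR (B * y) * (\prod_(b <- s) ('X - b%:P)).[y]| *
  expR (y ^+ 2 * S).
have fG y : `|f y| <= (y - a) ^+ 2 * G y.
  apply: (cvgr_to_le (cvg_norm (@partial_cvg y))).
  exists n => // N /= nN; rewrite (partial_split _ nN) normrM /G mulrA.
  apply: ler_pM => //; last exact: tail_le.
  rewrite pn (perm_big _ p) !big_cons horner_prod.
  under [in leRHS]eq_bigr do rewrite hornerXsubC.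
  rewrite -[in leRHS](@ger0_norm _ ((y - a) ^+ 2)) ?sqr_ge0// -normrM.
  rewrite /= le_eqVlt; apply/orP; left; apply/eqP; congr `|_|.
  by ring.
have cG : {for a, continuous G}.
  apply: cvgM; last first.
    apply: continuous_comp; last exact: continuous_expR.
    by apply: cvgM; [exact: exprn_continuous | exact: cvg_cst].
  apply: cvg_norm; apply: cvgM; last exact: continuous_horner.
  apply: cvgM; first exact: cvg_cst.
  apply: continuous_comp; last exact: continuous_expR.
  by apply: cvgM; [exact: cvg_cst | exact: cvg_id].
rewrite derive1n1 /derive1; apply: cvg_lim; first exact: Rhausdorff.
rewrite (partial_zeros_limit an).
have hG : `|h| * G (h + a) @[h --> 0^'] --> (0 : R).
  have norm0 : `|h| @[h --> (0 : R)] --> (0 : R).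
    by have := @norm_continuous _ R (0 : R); rewrite /continuous_at normr0.
  have shift : h + a @[h --> (0 : R)] --> a.
    have : h + a @[h --> (0 : R)] --> 0 + a.
      by apply: cvgD; [exact: cvg_id | exact: cvg_cst].
    by rewrite add0r.
  have : `|h| * G (h + a) @[h --> (0 : R)] --> 0 * G a.
    by apply: cvgM => //; exact: cvg_comp shift cG.
  by rewrite mul0r => prod0; apply: (cvg_within_filter _ prod0).
apply/norm_cvg0P.
apply: (squeeze_cvgr _ (cvg_cst 0) hG).
near=> h; rewrite normr_ge0 /= subr0 normrZ normfV.
have h0 : 0 < `|h| by rewrite normr_gt0; near: h; exact: nbhs_dnbhs_neq.
rewrite mulrC ler_pdivrMr//; apply: le_trans (fG _) _.
by rewrite addrK -real_normK ?num_real// expr2 mulrAC.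
Unshelve. all: by end_near.
Qed.

(** The mesh controls consecutive zeros only. By local finiteness of the zeros there
is a first zero after [a], and it is at most [b]. *)
Lemma limit_zeros_gap d a b :
  (d%:E <= mesh f)%E -> a < b -> f a = 0 -> f b = 0 -> d <= b - a.
Proof.
move=> dm ab fa fb.
have [n hn] := limit_zeros_bounded (Num.max `|a| `|b|).
have inn y : a <= y <= b -> f y = 0 -> y \in partial_zeros n.
  move=> /andP[ay yb]; apply: hn; rewrite le_max.
  have [y0|y0] := leP 0 y; apply/orP.
    by right; rewrite ger0_norm// (le_trans yb)// ler_norm.
  by left; rewrite ltr0_norm// -normrN (le_trans _ (ler_norm _))// lerN2.
pose z := \big[Num.min/b]_(y <- partial_zeros n | a < y) y.
have zb : z <= b by exact: bigmin_le_id.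
have [az fz] : a < z /\ f z = 0.
  rewrite /z big_seq_cond; elim/big_ind : _ => //.
    by move=> x y [? ?] [? ?]; rewrite /Num.min; case: ifP.
  by move=> y /andP[/partial_zeros_limit].
have : (mesh f <= (z - a)%:E)%E.
  apply: ereal_inf_lbound; exists a, z; split=> //; left; split=> // y ay yz fy.
  have : z <= y.
    apply: (ge_bigmin_seq b) => //; apply: inn => //.
    by rewrite (ltW ay) (ltW (lt_le_trans yz zb)).
  by rewrite leNgt yz.
move=> /(le_trans dm); rewrite lee_fin; lra.
Qed.

Lemma partial_zeros_separated n d :
  0 < d -> (d%:E <= mesh f)%E -> separated d (partial_zeros n).
Proof.
move=> d0 dm; split; last first.
  move=> a b /partial_zeros_limit fa /partial_zeros_limit fb ab.
  exact: limit_zeros_gap.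
apply/count_mem_uniq => a.
have [an|/count_memPn//] := boolP (a \in partial_zeros n).
have p := perm_to_rem an.
have [an'|an'] := boolP (a \in rem a (partial_zeros n)); last first.
  by rewrite (permP p) /= eqxx (count_memPn an').
have p2 : perm_eq (partial_zeros n)
    [:: a, a & rem a (rem a (partial_zeros n))].
  by apply: (perm_trans p); rewrite perm_cons perm_to_rem.
have : (mesh f <= 0%:E)%E.
  apply: ereal_inf_lbound; exists a, a; rewrite subrr; split=> //.
  by right; split=> //; apply: double_zero_limit p2.
by move=> /(le_trans dm); rewrite lee_fin leNgt d0.
Qed.

Lemma V_cvg m x : V m (partial n) x @[n --> \oo] --> V m f x.
Proof.
rewrite /V; apply: (cvg_big (@add_continuous R)) => i _ /=.
apply: cvgM; last exact: cvg_cst.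
by apply: cvgM; [exact: cvg_cst | apply: cvgM; exact: partial_cvg].
Qed.

End Product.

Theorem theorem1 (R : realType) (m : nat) (f : R -> R)
    (hf : LPO f)
    (hmesh : ((Num.sqrt (4 - 6 / (m + 2)%:R))%:E <= mesh f)%E) :
  forall x : R, 0 <= V m f x.
Proof.
move=> x; case: hf => _ [c [beta [r [omega [xk [_ sum_cvg prod_cvg]]]]]].
pose w k := if in_range omega k then (xk k)^-1 else 0.
have partial_cvg y : (partial c beta r w ^~ y @ \oo --> f y)%classic.
  rewrite (_ : partial c beta r w ^~ y = (fun n => c * y ^+ r * expR (beta * y) *
      \prod_(k < n | in_range omega k) ((1 + y / xk k) * expR (- (y / xk k)))))//.
  apply/funext => n; rewrite /partial [in RHS]big_mkcond; congr (_ * _).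
  apply: eq_bigr => k _; rewrite /primary_factor /w; case: ifP => // _.
  by rewrite mulr0 addr0 oppr0 expR0 mulr1.
pose sums n := \sum_(k < n | in_range omega k) xk k ^- 2.
have sum_w n : \sum_(k < n) w k ^+ 2 = sums n.
  rewrite /sums [RHS]big_mkcond; apply: eq_bigr => k _; rewrite /w.
  by case: ifP => _; rewrite ?exprVn// expr0n.
have wS n : \sum_(k < n) w k ^+ 2 <= (limn sums)%classic.
  rewrite sum_w; apply: nondecreasing_cvgn_le => //.
  apply/nondecreasing_seqP => k.
  by rewrite -!sum_w big_ord_recr lerDl sqr_ge0.
have V_lim := @V_cvg _ _ _ _ _ _ partial_cvg m x.
apply: (cvgr_to_ge V_lim); apply: nearW => n.
have [c0|c0] := eqVneq c 0.
  by rewrite /V big1// => i _; rewrite /= /partial c0 !mul0r mulr0 mul0r.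
have [C [B [_ pn]]] := partial_factored beta r w n c0.
have -> : partial c beta r w n =
    fun y => C * expR (B * y) * \prod_(a <- partial_zeros r w n) (y - a).
  exact/funext.
have m2 : 0 < (m + 2)%:R :> R by rewrite ltr0n addn2.
have dsq : 0 < 4 - 6 / (m + 2)%:R :> R.
  rewrite subr_gt0 ltr_pdivrMr// natrD.
  have := ler0n R m; lra.
rewrite V_exp_prod mulr_ge0 ?sqr_ge0//.
apply: (@divdiff_sq_ge0 _ _ (Num.sqrt (4 - 6 / (m + 2)%:R))); first exact: sqrtr_ge0.
  rewrite sqr_sqrtr ?(ltW dsq)// -natrD le_eqVlt; apply/orP; left; apply/eqP.
  rewrite natrD in m2 *; field; exact: lt0r_neq0.
apply: (partial_zeros_separated c0 wS partial_cvg) => //.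
by rewrite sqrtr_gt0.
Qed.
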